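(* Suppose each $f_i$ is convex and $L$-smooth (the case $\mu=0$), and that $W$ is a weight matrix as described in the context. Let $L_\epsilon=L+\epsilon$, $F_\epsilon(x)=\frac1m\sum_{i=1}^m f_i(x)+\frac{\epsilon}{2}\|x\|^2$ and $x_\epsilon^*=\arg\min_x F_\epsilon(x)$. Let $v^0\in\mathrm{Span}(U^2)$ (columnwise), $\alpha=\frac{1}{2(L_\epsilon+\beta)}$ and $\beta=L_\epsilon$. Run EXTRA on the regularized problem $\min_x F_\epsilon(x)$ in two stages: the first stage starts from $(x^0,v^0)$ and runs $K_0$ iterations; the second stage starts from the output $(x^{K_0},v^{K_0})$ of the first stage, runs $K$ iterations, with iterates re-indexed $x^1,\dots,x^K$, and outputs $\hat x^K=\frac1K\sum_{k=1}^K x^k$. Then one only needs $$O\left(\left(\frac{L}{\epsilon}+\frac{1}{1-\sigma_2(W)}\right)\log\frac{1}{1-\sigma_2(W)}\right)$$ iterations for the first stage and $K=O\left(\frac{LR_1+R_2/L}{\epsilon}\right)$ iterations for the second stage such that $$F_\epsilon(\alpha(\hat x^K))-F_\epsilon(x_\epsilon^* )\le\epsilon\quad\text{and}\quad\frac1m\sum_{i=1}^m\left\|\hat x^K_{(i)}-\alpha(\hat x^K)\right\|^2\le\epsilon^2 .$$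
   Context: Setting: $m$ agents form an undirected network; $f_1,\dots,f_m:\mathbb{R}^n\to\mathbb{R}$ are differentiable and convex, and $F(x)=\frac1m\sum_{i=1}^m f_i(x)$ has a minimizer $x^*$. $\epsilon>0$ is the target accuracy. $f_i$ is $L$-smooth if $f_i(y)\le f_i(x)+\langle\nabla f_i(x),y-x\rangle+\frac{L}{2}\|y-x\|^2$ for all $x,y$. For $x\in\mathbb{R}^{m\times n}$ with rows $x_{(1)}^T,\dots,x_{(m)}^T$, put $f(x)=\sum_{i} f_i(x_{(i)})$, $f_\epsilon(x)=f(x)+\frac{\epsilon}{2}\|x\|_F^2$, whose gradient $\nabla f_\epsilon(x)\in\mathbb{R}^{m\times n}$ has rows $(\nabla f_i(x_{(i)})+\epsilon x_{(i)})^T$, and let $\alpha(x)=\frac1m\sum_i x_{(i)}$ (not to be confused with the step-size $\alpha$). Weight matrix: $W\in\mathbb{R}^{m\times m}$ with $W_{i,j}\ne0$ if and only if agents $i,j$ are neighbors or $i=j$; $W=W^T$, $I\succeq W\succeq -I$, $W\mathbf{1}=\mathbf{1}$; and $\sigma_2(W)<1$, where $\sigma_2(W)$ is the second largest singular value of $W$. $U=\sqrt{(I-W)/2}$; $\mathrm{Span}(\cdot)$ is the linear span of the columns. EXTRA on the regularized problem, with parameters $\alpha,\beta$, iterates $$x^{k+1}=x^k-\alpha\left(\nabla f_\epsilon(x^k)+v^k+\tfrac{\beta}{2}(I-W)x^k\right),\qquad v^{k+1}=v^k+\tfrac{\beta}{2}(I-W)x^{k+1}.$$ $R_1,R_2$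 are such that $\|x_{(i)}^0-x^*\|^2\le R_1$, $\|x^*\|^2\le R_1$, $\|\nabla f_i(x^* )\|^2\le R_2$ for all $i$. Convention: in the complexities $O(\cdot)$, only $R_1$ and $R_2$ are regarded as constants that can be dropped.
   Formalization: The hidden constants may also depend on a bound for the squared row norms of v^0 (no count independent of v^0 can hold), the second-stage bound is O(max(1,(L R_1+R_2/L)/ε)) since the claim fails for large ε, and R_1, R_2 are taken positive. *)

(* Defs.v *)
From HB Require Import structures.
From mathcomp Require Import all_boot all_order all_algebra.
From mathcomp Require Import all_classical all_reals all_analysis.

Set Implicit Arguments.
Unset Strict Implicit.
Unset Printing Implicit Defensive.

Import Order.TTheory GRing.Theory Num.Theory.
Import numFieldNormedType.Exports.

Local Open Scope classical_set_scope.
Local Open Scope ring_scope.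

(* Points of R^n are row vectors.  The norm `|x| that MathComp-Analysis puts on
   matrices is the max norm, hence the Euclidean structure below. *)
Definition dotp (R : realType) (n : nat) (x y : 'rV[R]_n) : R :=
  \sum_j x 0 j * y 0 j.

Definition sqnorm (R : realType) (n : nat) (x : 'rV[R]_n) : R := dotp x x.

Definition grad (R : realType) (n : nat) (f : 'rV[R]_n -> R) (x : 'rV[R]_n) :
    'rV[R]_n :=
  \row_j 'D_(delta_mx 0 j) f x.

Definition smooth (R : realType) (n : nat) (L : R) (f : 'rV[R]_n -> R) : Prop :=
  forall x y, f y <= f x + dotp (grad f x) (y - x) + L / 2 * sqnorm (y - x).

Definition is_minimizer (R : realType) (n : nat) (F : 'rV[R]_n -> R)
    (x : 'rV[R]_n) : Prop :=
  forall y, F x <= F y.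

Definition psd (R : realType) (n : nat) (A : 'M[R]_n) : Prop :=
  A^T = A /\ forall x : 'cV[R]_n, 0 <= (x^T *m A *m x) 0 0.

(* Symmetric positive semidefinite square root (unique; it exists iff A is
   itself positive semidefinite, otherwise the value is 0). *)
Definition sqrtmx (R : realType) (n : nat) (A : 'M[R]_n) : 'M[R]_n :=
  xget 0 [set U | psd U /\ U *m U = A].

(* Singular values with multiplicity, in decreasing order: the nonnegative
   square roots of the eigenvalues of A^T A. *)
Definition singular_values (R : realType) (n : nat) (A : 'M[R]_n) : seq R :=
  xget [::] [set s : seq R |
    [/\ sorted >=%R s, all (>= 0) s &
        char_poly (A^T *m A) = \prod_(z <- s) ('X - (z ^+ 2)%:P)]].

(* Equals 0 when n = 1, where there is no second singular value. *)
Definition sigma2 (R : realType) (n : nat) (A : 'M[R]_n) : R :=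
  (singular_values A)`_1.

Definition simple_graph (m : nat) (nbr : rel 'I_m) : Prop :=
  symmetric nbr /\ irreflexive nbr.

Definition weight_matrix (R : realType) (m : nat) (nbr : rel 'I_m)
    (W : 'M[R]_m) : Prop :=
  [/\ forall i j, W i j != 0 <-> nbr i j \/ i = j,
      W^T = W,
      psd (1%:M - W) /\ psd (W + 1%:M),
      W *m const_mx 1 = const_mx 1 :> 'cV[R]_m &
      sigma2 W < 1].

Section Objective.
Variables (R : realType) (m n : nat) (f : 'I_m -> 'rV[R]_n -> R).

Definition avg_obj (x : 'rV[R]_n) : R := m%:R^-1 * \sum_i f i x.

Definition reg_obj (eps : R) (x : 'rV[R]_n) : R :=
  avg_obj x + eps / 2 * sqnorm x.

Definition reg_grad (eps : R) (x : 'M[R]_(m, n)) : 'M[R]_(m, n) :=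
  \matrix_(i < m) (grad (f i) (row i x) + eps *: row i x).

End Objective.

Definition row_avg (R : realType) (m n : nat) (x : 'M[R]_(m, n)) : 'rV[R]_n :=
  m%:R^-1 *: \sum_i row i x.

(* The state is the pair (x, v); note that v is updated with the new x. *)
Definition extra_step (R : realType) (m n : nat)
    (g : 'M[R]_(m, n) -> 'M[R]_(m, n)) (W : 'M[R]_m) (alpha beta : R)
    (s : 'M[R]_(m, n) * 'M[R]_(m, n)) : 'M[R]_(m, n) * 'M[R]_(m, n) :=
  let x := s.1 - alpha *: (g s.1 + s.2 + (beta / 2) *: ((1%:M - W) *m s.1)) in
  (x, s.2 + (beta / 2) *: ((1%:M - W) *m x)).

Definition extra (R : realType) (m n : nat)
    (g : 'M[R]_(m, n) -> 'M[R]_(m, n)) (W : 'M[R]_m) (alpha beta : R)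
    (s : 'M[R]_(m, n) * 'M[R]_(m, n)) (k : nat) : 'M[R]_(m, n) * 'M[R]_(m, n) :=
  iter k (extra_step g W alpha beta) s.

(* Main.v *)
Require Import Defs.
From HB Require Import structures.
From mathcomp Require Import all_boot all_order all_algebra.
From mathcomp Require Import all_classical all_reals all_analysis.
From mathcomp Require Import ring lra complex.
Set Implicit Arguments.
Unset Strict Implicit.
Unset Printing Implicit Defensive.
Import Order.TTheory GRing.Theory Num.Theory.
Import numFieldNormedType.Exports.
Local Open Scope classical_set_scope.
Local Open Scope ring_scope.

(* Write A = (beta/2)(I - W), l = L + eps, and let xs be the consensus point all
   of whose rows are the minimizer of the regularized objective.  The gradient at
   xs has zero column sums, hence lies in the range of A, and so does v^0: the
   dual error is v + grad(xs) = A q for some q.  With y = x - xs and D the Bregman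
   distance from xs, one step satisfies
     E' + 2 D(x') + eps |y|^2 + |y|_A^2 + 2 l |x' - x|^2 <= E,
   where E = 4 l |y|^2 + |q|_A^2.  As |q|_A^2 <= 2 |A q|^2 / (l (1 - sigma2)) and
   A q is a combination of x' - x, A y and a gradient difference of squared norm
   at most 2 l D(x), the function E + D contracts by a factor
   1 - 1 / O(L/eps + 1/(1 - sigma2)).  The first stage therefore multiplies it by
   (1 - sigma2)^2, which absorbs both the 1/(1 - sigma2) in the initial |q|_A^2 and
   the one lost when bounding the consensus error by |xhat|_A^2.  In the second
   stage the inequality is telescoped: 2 K D(xhat) <= E, and
   K (xhat - xs) = q^K - q^0 gives K^2 |xhat|_A^2 <= 4 E. *)

(** * Frobenius inner product and Bregman distance *)

Definition fip (R : realType) (m n : nat) (x y : 'M[R]_(m, n)) : R :=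
  \sum_i \sum_j x i j * y i j.

Section Frobenius.
Variables (R : realType) (m n : nat).
Implicit Types (x y z : 'M[R]_(m, n)) (A : 'M[R]_m) (a : R).

Lemma fipC x y : fip x y = fip y x.
Proof. by apply: eq_bigr => i _; apply: eq_bigr => j _; rewrite mulrC. Qed.

Lemma fipDl x y z : fip (x + y) z = fip x z + fip y z.
Proof.
rewrite -big_split; apply: eq_bigr => i _ /=.
by rewrite -big_split; apply: eq_bigr => j _; rewrite mxE mulrDl.
Qed.

Lemma fipZl a x y : fip (a *: x) y = a * fip x y.
Proof.
rewrite mulr_sumr; apply: eq_bigr => i _ /=.
by rewrite mulr_sumr; apply: eq_bigr => j _; rewrite mxE mulrA.
Qed.

Lemma fipDr x y z : fip x (y + z) = fip x y + fip x z.
Proof. by rewrite fipC fipDl ![fip _ x]fipC. Qed.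

Lemma fipZr a x y : fip x (a *: y) = a * fip x y.
Proof. by rewrite fipC fipZl fipC. Qed.

Lemma fipNl x y : fip (- x) y = - fip x y.
Proof. by rewrite -scaleN1r fipZl mulN1r. Qed.

Lemma fipNr x y : fip x (- y) = - fip x y.
Proof. by rewrite -scaleN1r fipZr mulN1r. Qed.

Definition fipE := (fipDl, fipDr, fipNl, fipNr, fipZl, fipZr).

Lemma fip0l x : fip 0 x = 0.
Proof. by rewrite -(scale0r 0) fipZl mul0r. Qed.

Lemma fip_suml I (s : seq I) (F : I -> 'M[R]_(m, n)) y :
  fip (\sum_(i <- s) F i) y = \sum_(i <- s) fip (F i) y.
Proof.
by apply: (big_morph (fun x => fip x y)) => [u v|]; rewrite ?fipDl ?fip0l.
Qed.

Lemma fip_ge0 x : 0 <= fip x x.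
Proof. by do 2!(apply: sumr_ge0 => ? _); rewrite -expr2 sqr_ge0. Qed.

Lemma fip_eq0 x : fip x x <= 0 -> x = 0.
Proof.
move=> h; have /eqP : fip x x = 0 by apply/eqP; rewrite eq_le h fip_ge0.
rewrite psumr_eq0 => [/allP hi|i _]; last first.
  by apply: sumr_ge0 => j _; rewrite -expr2 sqr_ge0.
apply/matrixP => i j; have := hi i (mem_index_enum i); rewrite implyTb.
rewrite psumr_eq0 => [/allP/(_ j (mem_index_enum j))|k _]; last first.
  by rewrite -expr2 sqr_ge0.
by rewrite implyTb -expr2 sqrf_eq0 mxE => /eqP.
Qed.

Lemma fip_young a x y : 0 < a ->
  2 * fip x y <= a * fip x x + a^-1 * fip y y.
Proof.
move=> a0; have := fip_ge0 (a *: x - y); rewrite !fipE (fipC y x) => h.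
have : 0 <= a^-1 * (a * (a * fip x x) - a * fip x y - (a * fip x y - fip y y)).
  by apply: mulr_ge0; [rewrite invr_ge0 ltW | lra].
have -> : a^-1 * (a * (a * fip x x) - a * fip x y - (a * fip x y - fip y y)) =
   a * fip x x - 2 * fip x y + a^-1 * fip y y by field; rewrite gt_eqF.
lra.
Qed.

Lemma fipD_le x y : fip (x + y) (x + y) <= 2 * fip x x + 2 * fip y y.
Proof. by have := fip_ge0 (x - y); rewrite !fipE; lra. Qed.

Lemma fipB_le x y : fip (x - y) (x - y) <= 2 * fip x x + 2 * fip y y.
Proof. by have := fip_ge0 (x + y); rewrite !fipE; lra. Qed.

Lemma fip_mulmxC A x y : A^T = A -> fip x (A *m y) = fip y (A *m x).
Proof.
move=> sA; rewrite /fip exchange_big [RHS]exchange_big /=.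
apply: eq_bigr => j _.
under eq_bigr => i _ do rewrite mxE mulr_sumr.
rewrite exchange_big; apply: eq_bigr => i _ /=.
rewrite mxE mulr_sumr; apply: eq_bigr => k _.
by rewrite -[in LHS]sA mxE; ring.
Qed.

End Frobenius.

Lemma dotpE (R : realType) n (x y : 'rV[R]_n) : dotp x y = fip x y.
Proof. by rewrite /fip big_ord1. Qed.

Lemma sqnormE (R : realType) n (x : 'rV[R]_n) : sqnorm x = fip x x.
Proof. exact: dotpE. Qed.

Lemma fip_rows (R : realType) m n (x y : 'M[R]_(m, n)) :
  fip x y = \sum_i fip (row i x) (row i y).
Proof.
apply: eq_bigr => i _; rewrite /fip big_ord1.
by apply: eq_bigr => j _; rewrite !mxE.
Qed.

Section Bregman.
Variables (R : realType) (m n : nat).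
Variables (h : 'M[R]_(m, n) -> R) (g : 'M[R]_(m, n) -> 'M[R]_(m, n)).
Variables (mu l : R).
Hypothesis l0 : 0 < l.
Hypothesis mu0 : 0 <= mu.
Hypothesis h_lower : forall x y,
  h x + fip (g x) (y - x) + mu / 2 * fip (y - x) (y - x) <= h y.
Hypothesis h_upper : forall x y,
  h y <= h x + fip (g x) (y - x) + l / 2 * fip (y - x) (y - x).

Definition bregman (h : 'M[R]_(m, n) -> R) (g : 'M[R]_(m, n) -> 'M[R]_(m, n))
  (xs x : 'M[R]_(m, n)) : R := h x - h xs - fip (g xs) (x - xs).
Local Notation D := (bregman h g).

Lemma bregman_ge0 xs x : 0 <= D xs x.
Proof.
have := h_lower xs x; have := fip_ge0 (x - xs); rewrite /bregman => p.
have : 0 <= mu / 2 * fip (x - xs) (x - xs) by rewrite mulr_ge0 ?divr_ge0.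
lra.
Qed.

Lemma bregman_le xs x : D xs x <= l / 2 * fip (x - xs) (x - xs).
Proof. by have := h_upper xs x; rewrite /bregman; lra. Qed.

(** [D xs] differs from [h] by an affine map, so it inherits the quadratic upper bound, with
    [g x - g xs] as gradient. *)
Lemma bregman_upper xs x z :
  D xs z <= D xs x + fip (g x - g xs) (z - x) + l / 2 * fip (z - x) (z - x).
Proof. by have := h_upper x z; rewrite /bregman !fipE; lra. Qed.

Lemma bregman_tangent xs x z : D xs x + fip (g x - g xs) (z - x) <= D xs z.
Proof.
have := h_lower x z; have := fip_ge0 (z - x) => p.
have : 0 <= mu / 2 * fip (z - x) (z - x) by rewrite mulr_ge0 ?divr_ge0.
by rewrite /bregman !fipE; lra.
Qed.

(** Three-point inequality: the upper bound from [x] to [x1] is combined with the lower bound from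
    [x] to [xs]. *)
Lemma bregman_step xs x x1 :
  D xs x1 <= fip (g x - g xs) (x1 - xs) + l / 2 * fip (x1 - x) (x1 - x)
             - mu / 2 * fip (x - xs) (x - xs).
Proof.
have := h_upper x x1; have := h_lower x xs.
have -> : fip (xs - x) (xs - x) = fip (x - xs) (x - xs) by rewrite !fipE; ring.
by rewrite /bregman !fipE; lra.
Qed.

(** A gradient step of length [1 / l] from [x] lowers [D xs] by at least [|g x - g xs|^2 / (2 l)],
    and [D xs] stays nonnegative. *)
Lemma bregman_coco xs x : fip (g x - g xs) (g x - g xs) <= 2 * l * D xs x.
Proof.
have := bregman_upper xs x (x - l^-1 *: (g x - g xs)).
have := bregman_ge0 xs (x - l^-1 *: (g x - g xs)).
set G := g x - g xs.
rewrite (_ : x - l^-1 *: G - x = - (l^-1 *: G)); last by rewrite addrAC subrr add0r.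
rewrite !(fipNl, fipNr, fipZl, fipZr) opprK => h1 h2.
have := le_trans h1 h2; rewrite mulrA => h3.
have : 0 <= 2 * l * (D xs x - l^-1 * fip G G + l / 2 * l^-1 * (l^-1 * fip G G)).
  by apply: mulr_ge0; [apply: mulr_ge0 => //; exact: ltW | lra].
have -> : 2 * l * (D xs x - l^-1 * fip G G + l / 2 * l^-1 * (l^-1 * fip G G)) =
  2 * l * D xs x - fip G G by field; rewrite gt_eqF.
lra.
Qed.

(** Sum the tangent inequalities at the average: the linear terms cancel. *)
Lemma bregman_jensen xs K (x : nat -> 'M[R]_(m, n)) : (0 < K)%N ->
  K%:R * D xs (K%:R^-1 *: \sum_(1 <= k < K.+1) x k) <=
  \sum_(1 <= k < K.+1) D xs (x k).
Proof.
move=> K0; set xh := _ *: _.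
have K0' : K%:R != 0 :> R by rewrite pnatr_eq0 -lt0n.
have -> : K%:R * D xs xh =
    \sum_(1 <= k < K.+1) (D xs xh + fip (g xh - g xs) (x k - xh)).
  rewrite big_split sumr_const_nat subn1 /= mulr_natl.
  rewrite [X in _ = _ + X](_ : _ = 0) ?addr0 //.
  under eq_bigr => i _ do rewrite fipC.
  rewrite -fip_suml sumrB sumr_const_nat subn1 /= -scaler_nat.
  by rewrite scalerA divff // scale1r subrr fip0l.
by apply: ler_sum => k _; exact: bregman_tangent.
Qed.

End Bregman.

(** * One step of EXTRA and its Lyapunov function *)

Local Arguments extra_step : simpl never.

Section ExtraAnalysis.
Variables (R : realType) (m n : nat).
Variables (h : 'M[R]_(m, n) -> R) (g : 'M[R]_(m, n) -> 'M[R]_(m, n)).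
Variables (mu l c : R) (W : 'M[R]_m) (xs : 'M[R]_(m, n)).
Hypotheses (mu0 : 0 < mu) (l0 : 0 < l) (c0 : 0 < c).
Hypothesis h_lower : forall x y,
  h x + fip (g x) (y - x) + mu / 2 * fip (y - x) (y - x) <= h y.
Hypothesis h_upper : forall x y,
  h y <= h x + fip (g x) (y - x) + l / 2 * fip (y - x) (y - x).
Local Notation D := (bregman h g xs).
Local Notation A := ((l / 2) *: (1%:M - W)).
Hypothesis symA : A^T = A.
Hypothesis A_ge0 : forall z : 'M[R]_(m, n), 0 <= fip z (A *m z).
Hypothesis A_le : forall z : 'M[R]_(m, n), fip z (A *m z) <= l * fip z z.
Hypothesis A_gap : forall z : 'M[R]_(m, n),
  l * c * fip z (A *m z) <= 2 * fip (A *m z) (A *m z).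
Hypothesis A_xs : A *m xs = 0.
Local Notation step := (extra_step g W (2 * (l + l))^-1 l).

(* The norm of v + g xs in the pseudo-inverse of A is the A-seminorm of q, which
   avoids both the square root of A and its pseudo-inverse. *)
Definition dual_cert (s : 'M[R]_(m, n) * 'M[R]_(m, n)) (q : 'M[R]_(m, n)) :=
  s.2 + g xs = A *m q.

(** The weight [4 * l] is the inverse of the step size [(2 * (l + l))^-1]. *)
Definition energy (s : 'M[R]_(m, n) * 'M[R]_(m, n)) (q : 'M[R]_(m, n)) : R :=
  4 * l * fip (s.1 - xs) (s.1 - xs) + fip q (A *m q).

(** With [x1] the new iterate, [v] grows by [A x1], which is [A (x1 - xs)] because [A xs = 0]. *)
Lemma dual_cert_step s q :
  dual_cert s q -> dual_cert (step s) (q + ((step s).1 - xs)).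
Proof.
rewrite /dual_cert => hs; rewrite mulmxDr -hs mulmxBr A_xs subr0 [in LHS]/extra_step.
by rewrite /= scalemxAl addrAC.
Qed.

(** This is [A^2 <= l A] without a square root of [A]: positivity of [A] at [l z - A z] is combined
    with [A <= l] at [A z]. *)
Lemma norm_mulA_le (z : 'M[R]_(m, n)) : fip (A *m z) (A *m z) <= l * fip z (A *m z).
Proof.
set w := A *m z.
have h1 := A_ge0 (l *: z - w); have h2 := A_le w.
move: h1; rewrite mulmxBr -scalemxAr -/w !fipE.
rewrite (fip_mulmxC z w symA) -/w => h1.
have : 0 <= l * (l * fip z w - fip w w) by lra.
by rewrite pmulr_rge0 // subr_ge0.
Qed.

Let alphaE : 4 * l * (2 * (l + l))^-1 = 1.
Proof. by field; rewrite gt_eqF // addr_gt0. Qed.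

(** Let [d] be the primal increment. Substituting the update into twice [bregman_step] leaves
    [-4 l |d|^2] from the three-point identity, [+ l |d|^2] from smoothness and [+ |d|_A^2] from
    completing the square in [A]. The last is at most [l |d|^2], so [-2 l |d|^2] remains. *)
Lemma extra_descent s q : dual_cert s q ->
  energy (step s) (q + ((step s).1 - xs)) + 2 * D (step s).1
  + mu * fip (s.1 - xs) (s.1 - xs) + fip (s.1 - xs) (A *m (s.1 - xs))
  + 2 * l * fip ((step s).1 - s.1) ((step s).1 - s.1) <= energy s q.
Proof.
move=> hs; rewrite /energy.
have := bregman_step h_lower h_upper xs s.1 (step s).1.
set x1 := (step s).1; set y := s.1 - xs; set y1 := x1 - xs.
have dy : x1 - s.1 = y1 - y by rewrite /y /y1 opprB addrA subrK.
have hG : g s.1 - g xs = (4 * l) *: (y - y1) - A *m q - A *m y.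
  have -> : y - y1 = s.1 - x1 by rewrite /y /y1 opprB addrA subrK.
  rewrite -hs /y mulmxBr A_xs subr0 /x1 /extra_step /= subKr scalerA alphaE.
  rewrite scale1r scalemxAl; move: (A *m _) => w.
  by apply/matrixP => i j; rewrite !mxE; ring.
have hle := A_le (y1 - y).
rewrite hG dy; move: hle; clearbody y1 y; rewrite !(mulmxDr, mulmxN) !fipE.
rewrite (fipC y1 y) (fip_mulmxC y1 q symA) (fip_mulmxC y1 y symA).
rewrite (fipC (A *m q) y1) (fipC (A *m y) y1) (fip_mulmxC y1 q symA).
rewrite (fip_mulmxC y1 y symA).
lra.
Qed.

(** The update gives [A q = -(4 l d + G + A y)], with [G] the gradient difference. The three squared
    norms are at most [16 l^2 |d|^2], [2 l D] and [l |y|_A^2]; the first one sets the constant, as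
    [2 * 3 * 16 = 48 * 2]. *)
Lemma cert_norm_le s q : dual_cert s q ->
  fip q (A *m q) <= 48 / c * (2 * l * fip ((step s).1 - s.1) ((step s).1 - s.1)
    + D s.1 + fip (s.1 - xs) (A *m (s.1 - xs))).
Proof.
move=> hs.
have hco := bregman_coco l0 (ltW mu0) h_lower h_upper xs s.1.
have hAy := norm_mulA_le (s.1 - xs).
have hg := A_gap q.
move: hco hAy; set x1 := (step s).1; set y := s.1 - xs; set G := g s.1 - g xs.
set d := x1 - s.1; set w := A *m y => hco hAy.
have hAq : A *m q = - ((4 * l) *: d + G + w).
  have -> : d = - ((2 * (l + l))^-1 *:
      (g s.1 + s.2 + (l / 2) *: ((1%:M - W) *m s.1))).
    by rewrite /d /x1 /extra_step /= addrAC subrr add0r.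
  rewrite -hs /w /y mulmxBr A_xs subr0 /G scalerN scalerA alphaE scale1r.
  rewrite scalemxAl; move: (A *m _) => z.
  by apply/matrixP => i j; rewrite !mxE; ring.
have h3 : fip (A *m q) (A *m q) <=
    3 * (16 * l * l * fip d d + fip G G + fip w w).
  rewrite hAq; clearbody d G w; rewrite !fipE.
  have := fip_ge0 ((4 * l) *: d - G); have := fip_ge0 ((4 * l) *: d - w).
  have := fip_ge0 (G - w); rewrite !fipE (fipC G d) (fipC w d) (fipC w G).
  lra.
have h4 : l * c * fip q (A *m q) <=
  l * c * (48 / c * (2 * l * fip d d + D s.1 + fip y w)).
  have -> : l * c * (48 / c * (2 * l * fip d d + D s.1 + fip y w)) =
     48 * l * (2 * l * fip d d + D s.1 + fip y w) by field; rewrite gt_eqF.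
  have : 0 <= l * fip y w by rewrite mulr_ge0 ?A_ge0 // ltW.
  have : 0 <= l * D s.1.
    by rewrite mulr_ge0 ?(bregman_ge0 (ltW mu0) h_lower) // ltW.
  have : 0 <= l * l * fip d d by rewrite !mulr_ge0 ?fip_ge0 // ltW.
  lra.
by move: h4; rewrite ler_pM2l // mulr_gt0.
Qed.

(** [D s.1] is included because the descent yields the distance at the new point, while
    [cert_norm_le] needs it at the old one. *)
Definition lyapunov s q : R := energy s q + D s.1.

Lemma energy_ge0 s q : 0 <= energy s q.
Proof. by rewrite addr_ge0 ?A_ge0 // !mulr_ge0 ?fip_ge0 // ltW. Qed.

Lemma energy_le_lyapunov s q : energy s q <= lyapunov s q.
Proof. by rewrite lerDl (bregman_ge0 (ltW mu0) h_lower). Qed.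

(** One step loses at least [S = D + mu |y|^2 + |y|_A^2 + 2 l |d|^2], and the old value is at most
    [dt * S]: [4 l |y|^2] costs [4 l / mu], [|q|_A^2] costs [48 / c] and [D] costs 1. *)
Lemma lyapunov_step s q : dual_cert s q ->
  lyapunov (step s) (q + ((step s).1 - xs)) <=
  (1 - (1 + 48 / c + 4 * l / mu)^-1) * lyapunov s q.
Proof.
move=> hs; have hd := extra_descent hs; have hq := cert_norm_le hs.
have D0 := bregman_ge0 (ltW mu0) h_lower xs.
have := D0 s.1; have := D0 (step s).1; have := fip_ge0 (s.1 - xs).
have := fip_ge0 ((step s).1 - s.1); have := A_ge0 (s.1 - xs).
move: hd hq; rewrite /lyapunov [energy s q]/energy.
set E1 := energy _ _; set D1 := D (step s).1; set D2 := D s.1.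
set Y := fip (s.1 - xs) (s.1 - xs); set Z := fip (s.1 - xs) (A *m _).
set P := fip (_ - s.1) _; set Q := fip q _ => hd hq Z0 P0 Y0 D10 D20.
set dt := 1 + _ + _; set S := D2 + mu * Y + Z + 2 * l * P.
have k0 : 0 <= 48 / c by rewrite divr_ge0 // ltW.
have r0 : 0 <= 4 * l / mu by rewrite divr_ge0 ?mulr_ge0 // ltW.
have dt0 : 0 < dt by rewrite /dt; lra.
have lP0 : 0 <= l * P by rewrite mulr_ge0 // ltW.
have mY0 : 0 <= mu * Y by rewrite mulr_ge0 // ltW.
have hV : 4 * l * Y + Q + D2 <= dt * S.
  have -> : 4 * l * Y = 4 * l / mu * (mu * Y) by field; rewrite gt_eqF.
  have : 0 <= 48 / c * (mu * Y) by apply: mulr_ge0.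
  have : 0 <= 4 * l / mu * (D2 + Z + 2 * l * P) by apply: mulr_ge0 => //; lra.
  by rewrite /dt /S; lra.
have : dt^-1 * (4 * l * Y + Q + D2) <= S by rewrite ler_pdivrMl.
rewrite mulrBl mul1r /S; lra.
Qed.

Lemma lyapunov_iter s q k : dual_cert s q ->
  let t := extra g W (2 * (l + l))^-1 l s k in
  exists2 q', dual_cert t q' &
    lyapunov t q' <= (1 - (1 + 48 / c + 4 * l / mu)^-1) ^+ k * lyapunov s q.
Proof.
move=> hs /=; elim: k => [|k [q' hq' IH]]; first by exists q; rewrite ?mul1r.
rewrite /extra iterS -/(extra _ _ _ _ _ _); eexists; first exact: dual_cert_step hq'.
apply: le_trans (lyapunov_step hq') _; rewrite exprS -[leRHS]mulrA ler_wpM2l //.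
have k0 : 0 <= 48 / c by rewrite divr_ge0 // ltW.
have r0 : 0 <= 4 * l / mu by rewrite divr_ge0 ?mulr_ge0 // ltW.
by rewrite subr_ge0 invf_le1; lra.
Qed.

(** Telescopes [extra_descent]; the certificate is kept explicit so that its increment recovers the
    average iterate. *)
Lemma energy_sum s q K : dual_cert s q ->
  let t := extra g W (2 * (l + l))^-1 l s in
  let q' := q + \sum_(1 <= k < K.+1) ((t k).1 - xs) in
  dual_cert (t K) q' /\
  energy (t K) q' + 2 * \sum_(1 <= k < K.+1) D (t k).1 <= energy s q.
Proof.
move=> hs /=; elim: K => [|K [hq' IH]]; first by rewrite !big_geq ?addr0 ?mulr0 ?addr0.
move: IH hq'; set t := extra g W _ _ _ => IH hq'.
have tS : t K.+1 = step (t K) by [].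
clearbody t.
rewrite ![\sum_(1 <= k < K.+2) _]big_nat_recr //= tS.
rewrite addrA; split; first exact: dual_cert_step.
have := extra_descent hq'; have := A_ge0 ((t K).1 - xs).
have : 0 <= mu * fip ((t K).1 - xs) ((t K).1 - xs) by rewrite mulr_ge0 ?fip_ge0 // ltW.
have : 0 <= l * fip ((step (t K)).1 - (t K).1) ((step (t K)).1 - (t K).1).
  by rewrite mulr_ge0 ?fip_ge0 // ltW.
rewrite mulrDr; lra.
Qed.

Lemma ergodic_bounds s q K (e : R) : (0 < K)%N -> dual_cert s q ->
  energy s q <= e ->
  let xh := K%:R^-1 *:
    \sum_(1 <= k < K.+1) (extra g W (2 * (l + l))^-1 l s k).1 in
  K%:R * D xh <= e / 2 /\ K%:R ^+ 2 * fip (xh - xs) (A *m (xh - xs)) <= 4 * e.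
Proof.
move=> K0 hs he /=; set t := extra _ _ _ _ _; set xh := _ *: _.
have [_] := energy_sum K hs; rewrite -/t.
set q' := q + _; have D0 := bregman_ge0 (ltW mu0) h_lower xs.
have S0 : 0 <= \sum_(1 <= k < K.+1) D (t k).1 by apply: sumr_ge0.
have E0 := energy_ge0 (t K) q'; move=> hE; split.
  have := bregman_jensen (ltW mu0) h_lower xs (fun k => (t k).1) K0.
  rewrite -/xh; lra.
have dq : K%:R *: (xh - xs) = q' - q.
  rewrite /q' addrAC subrr add0r sumrB sumr_const_nat subn1 /=.
  by rewrite scalerBr /xh scalerA mulfV ?scale1r ?scaler_nat // pnatr_eq0 -lt0n.
have -> : K%:R ^+ 2 * fip (xh - xs) (A *m (xh - xs)) =
    fip (q' - q) (A *m (q' - q)).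
  by rewrite -dq -scalemxAr !fipE; ring.
have Q' : fip q' (A *m q') <= e.
  have : 0 <= 4 * l * fip ((t K).1 - xs) ((t K).1 - xs).
    by rewrite !mulr_ge0 ?fip_ge0 // ltW.
  by move: hE; rewrite /energy in he *; lra.
have Q : fip q (A *m q) <= e.
  have : 0 <= 4 * l * fip (s.1 - xs) (s.1 - xs) by rewrite !mulr_ge0 ?fip_ge0 // ltW.
  by rewrite /energy in he; lra.
(* Positivity at [q' + q] amounts to [|q' - q|_A^2 <= 2 |q'|_A^2 + 2 |q|_A^2]. *)
clearbody q'; have := A_ge0 (q' + q); rewrite !(mulmxDr, mulmxN) !fipE; lra.
Qed.

End ExtraAnalysis.

(** * The second singular value as a spectral gap *)

Section SecondSingularValue.
Variables (R : realType) (m : nat) (W : 'M[R]_m).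
Hypothesis symW : W^T = W.
Local Notation C := (R[i]%C).
Local Notation toC := (real_complex R).
Local Open Scope sesquilinear_scope.

(** As a complex matrix [W] is Hermitian, hence unitarily diagonalizable with real eigenvalues. *)
Lemma symmetric_spectral : exists (r : 'I_m -> R) (P : 'M[C]_m),
  P \is unitarymx /\
  map_mx toC W = P^t* *m diag_mx (\row_i toC (r i)) *m P.
Proof.
set Wc := map_mx toC W.
have herm : Wc \is hermsymmx.
  apply: realsym_hermsym.
    by apply/is_hermitianmxP; rewrite scale1r map_mx_id // /Wc map_trmx symW.
  by apply/mxOverP => i j; rewrite mxE; apply/complex_realP; exists (W i j).
have := hermitian_spectral_diag_real herm.
have /orthomx_spectralP := hermitian_normalmx herm.
have := spectral_unitarymx Wc.
set P := spectralmx Wc => uP eW /mxOverP dreal.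
exists (fun i => complex.Re (spectral_diag Wc 0 i)), P; split => //.
rewrite {1}eW invmx_unitary //; congr (_ *m diag_mx _ *m _).
by apply/rowP => i; rewrite mxE RRe_real.
Qed.

Lemma singular_char_poly (r : 'I_m -> R) (P : 'M[C]_m) : P \is unitarymx ->
  map_mx toC W = P^t* *m diag_mx (\row_i toC (r i)) *m P ->
  char_poly (W^T *m W) = \prod_i ('X - (r i ^+ 2)%:P).
Proof.
move=> uP eW; have inj := @map_poly_inj _ _ toC; apply: inj.
rewrite map_char_poly map_mxM symW eW.
rewrite rmorph_prod /=.
set d := diag_mx _.
have uP' : P *m P^t* = 1%:M by apply/unitarymxP.
have -> : P^t* *m d *m P *m (P^t* *m d *m P) = P^t* *m (d *m d) *m P.
  by rewrite !mulmxA -[_ *m P *m P^t*]mulmxA uP' mulmx1.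
have cM (M : 'M[C]_m) : char_poly (P^t* *m M *m P) = char_poly M.
  rewrite /char_poly /char_poly_mx.
  have -> : 'X%:M - map_mx polyC (P^t* *m M *m P) =
    map_mx polyC (P^t*) *m ('X%:M - map_mx polyC M) *m map_mx polyC P.
    rewrite mulmxBr mulmxBl !map_mxM; congr (_ - _).
    rewrite mul_mx_scalar -scalemxAl -map_mxM.
    by rewrite (mulmx1C uP') map_mx1 scalemx1.
  rewrite !det_mulmx mulrAC -det_mulmx -map_mxM (mulmx1C uP') map_mx1 det1.
  by rewrite mul1r.
rewrite cM char_poly_trig; last first.
  by rewrite mulmx_diag; apply: diag_mx_is_trig.
apply: eq_bigr => i _; rewrite mulmx_diag !mxE eqxx mulr1n.
by rewrite rmorphB /= map_polyX map_polyC /= -rmorphM.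
Qed.

Lemma sigma2_ge0 : 0 <= sigma2 W.
Proof.
rewrite /sigma2 /singular_values; case: xgetP => [s _ [_ /allP s0 _]|_] //.
(* With fewer than two entries, the default 0 is read. *)
have [h|h] := ltnP 1 (size s); last by rewrite nth_default.
by apply: s0; rewrite mem_nth.
Qed.

(** The factorization of [char_poly] fixes the squared singular values with multiplicity. Hence the
    [|r i|] above [sigma2 W] are as many as the entries of the decreasing list above its second one:
    at most one. *)
Lemma sigma2_bounds_all_but_one (r : 'I_m -> R) :
  char_poly (W^T *m W) = \prod_i ('X - (r i ^+ 2)%:P) ->
  (#|[pred i | (sigma2 W < `|r i|)%R]| <= 1)%N.
Proof.
move=> eW; rewrite cardE /enum_mem size_filter -enumT.
set t := [seq `|r i| | i <- enum 'I_m].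
have eWt : char_poly (W^T *m W) = \prod_(z <- t) ('X - (z ^+ 2)%:P).
  rewrite eW big_map big_enum /=; apply: eq_bigr => i _.
  by rewrite real_normK ?num_real.
(* The sorted [|r i|] witness that the [xget] defining the list succeeds. *)
have /(xgetPex [::]) : exists s, [set s : seq R |
    [/\ sorted >=%R s, all (>= 0) s &
        char_poly (W^T *m W) = \prod_(z <- s) ('X - (z ^+ 2)%:P)]] s.
  exists (sort >=%R t); split.
  - by apply: sort_sorted => x y; exact: le_total.
  - by rewrite all_sort; apply/allP => _ /mapP[i _ ->] /=.
  - by rewrite eWt; apply: perm_big; rewrite perm_sym perm_sort.
rewrite -/(singular_values W) /sigma2; set s := singular_values W => -[srt s0 eWs].
have pst : perm_eq [seq z ^+ 2 | z <- s] [seq z ^+ 2 | z <- t].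
  by apply: prod_XsubC_eq; rewrite big_map -eWs eWt [RHS]big_map.
have s1_ge0 : 0 <= s`_1 := sigma2_ge0.
have cnt (u : seq R) : all (>= 0) u ->
    count (fun z => s`_1 < z) u = count (fun z => s`_1 ^+ 2 < z) [seq z ^+ 2 | z <- u].
  move=> u0; rewrite count_map; apply: eq_in_count => z /(allP u0) /= z0.
  by rewrite ltr_pXn2r.
have t0 : all (>= 0) t by apply/allP => _ /mapP[i _ ->] /=.
have -> : count (mem [pred i | s`_1 < `|r i|]) (enum 'I_m) =
    count (fun z => s`_1 < z) t by rewrite [RHS]count_map; apply: eq_count.
rewrite cnt // -(permP pst) -cnt //.
case: s srt {s0 eWs pst s1_ge0 cnt} => [|a [|b s]] //=; first by rewrite addn0 leq_b1.
move=> /andP[_]; rewrite ltxx add0n (path_sortedE ge_trans) => /andP[/allP sb _].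
rewrite (_ : count _ s = 0%N) ?addn0 ?leq_b1 //; apply/eqP.
rewrite -leqn0 leqNgt -has_count; apply/hasPn => z /sb /=.
by rewrite -leNgt.
Qed.

Hypothesis W1 : W *m const_mx 1 = const_mx 1 :> 'cV[R]_m.
Hypothesis sig1 : sigma2 W < 1.

(* In an orthonormal eigenbasis, the all-ones vector has coordinates only along
   eigenvalue 1, hence only along the single eigenvector that sigma2 does not
   control; so x orthogonal to it only sees eigenvalues at most sigma2. *)
Lemma sigma2_rayleigh (x : 'rV[R]_m) : x *m (const_mx 1 : 'cV_m) = 0 ->
  fip x (x *m W) <= sigma2 W * fip x x.
Proof.
move=> x1; have [r [P [uP eW]]] := symmetric_spectral.
have hcard := sigma2_bounds_all_but_one (singular_char_poly uP eW).
have PP : P^t* *m P = 1%:M by apply/mulmx1C/unitarymxP.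
have uP' : P *m P^t* = 1%:M by apply/unitarymxP.
have := sig1; set s2 := sigma2 W in hcard * => s21.
pose coord (z : 'rV[R]_m) := map_mx toC z *m P^t*.
have coordW z i : coord (z *m W) 0 i = coord z 0 i * toC (r i).
  rewrite /coord map_mxM eW !mulmxA -[_ *m P *m P^t*]mulmxA uP' mulmx1.
  by rewrite mul_mx_diag; move: (_ *m P^t*) => c; rewrite !mxE.
have conjR (z : 'rV[R]_m) : (map_mx toC z)^t* = (map_mx toC z)^T.
  apply/matrixP => i j; rewrite !mxE; apply: conj_Creal.
  by apply/complex_realP; exists (z j i).
have parseval y z : toC (fip y z) = \sum_i coord y 0 i * (coord z 0 i)^*.
  have -> : \sum_i coord y 0 i * (coord z 0 i)^* = (coord y *m (coord z)^t*) 0 0.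
    by rewrite mxE; apply: eq_bigr => i _; rewrite !mxE.
  rewrite /coord trmx_mul map_mxM trmxCK mulmxA -[_ *m P^t* *m P]mulmxA PP mulmx1.
  rewrite conjR mxE -dotpE rmorph_sum; apply: eq_bigr => i _.
  by rewrite rmorphM !mxE.
pose u : 'rV[R]_m := const_mx 1.
have uW : u *m W = u by apply: trmx_inj; rewrite trmx_mul symW trmx_const W1.
have u_eig i : coord u 0 i != 0 -> r i = 1.
  move=> ui; have := coordW u i; rewrite uW -{1}[coord u 0 i]mulr1 => /(mulfI ui) /esym.
  by rewrite -(rmorph1 toC) => /complexI.
have fipux : fip x u = 0.
  have := congr1 (fun M : 'M[R]_1 => M 0 0) x1; rewrite !mxE => <-.
  by rewrite -dotpE; apply: eq_bigr => j _; rewrite !mxE.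
have u_nz : 0 < (m%:R : R) -> exists i, coord u 0 i != 0.
  move=> m0; apply/existsP; apply/contraT; rewrite negb_exists => /forallP h.
  have : toC (fip u u) = 0.
    rewrite parseval big1 // => i _; move: (h i); rewrite negbK => /eqP ->.
    by rewrite mul0r.
  rewrite -(rmorph0 toC) => /complexI; rewrite -dotpE /dotp.
  under eq_bigr => j _ do rewrite !mxE mulr1.
  by rewrite sumr_const card_ord => h0; rewrite h0 ltxx in m0.
(* An index with [r i] above [s2] would be unique, hence would carry all of [u]; then [fip x u]
   would be a single nonzero product, against orthogonality. *)
have big_r i : coord x 0 i != 0 -> r i <= s2.
  move=> xi; rewrite leNgt; apply/negP => ri.
  have m0 : 0 < (m%:R : R) by rewrite ltr0n (leq_ltn_trans _ (ltn_ord i)).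
  have [j uj] := u_nz m0.
  have uniq_i k : s2 < r k -> k = i.
    move=> rk; move/card_le1_eqP: hcard; apply; rewrite inE /=.
      exact: lt_le_trans ri (ler_norm _).
    exact: lt_le_trans rk (ler_norm _).
  have ij : j = i by apply: uniq_i; rewrite (u_eig _ uj).
  subst j.
  have := parseval x u; rewrite fipux rmorph0 (bigD1 i) //= big1 ?addr0.
    move/esym/eqP; rewrite mulf_eq0 (negPf xi) /= conjC_eq0.
    by rewrite (negPf uj).
  move=> k ki; have [->|/u_eig rk] := eqVneq (coord u 0 k) 0.
    by rewrite conjC0 mulr0.
  by move: ki; rewrite (uniq_i k) ?eqxx // rk.
suff : toC (fip x (x *m W)) <= toC (s2 * fip x x) by rewrite lecR.
rewrite rmorphM /= !parseval mulr_sumr; apply: ler_sum => i _.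
rewrite coordW rmorphM /=.
have [->|xi] := eqVneq (coord x 0 i) 0; first by rewrite !mul0r mulr0.
have -> : (toC (r i))^* = toC (r i).
  by apply: conj_Creal; apply/complex_realP; exists (r i).
rewrite mulrA [leLHS]mulrC ler_wpM2r ?mul_conjC_ge0 //.
by rewrite lecR; exact: big_r.
Qed.

End SecondSingularValue.

(** * The tangent inequality for convex functions *)

Section FirstOrder.
Variables (R : realType) (n : nat) (f : 'rV[R]_n -> R).
Hypothesis f_diff : forall x, differentiable f x.

Lemma dotp_grad x v : dotp (grad f x) v = 'D_v f x.
Proof.
rewrite deriveE // {2}(row_sum_delta v) linear_sum; apply: eq_bigr => j _.
by rewrite linearZ mxE deriveE // mulrC.
Qed.

(** By convexity, each difference quotient towards [y] with [0 < t <= 1] is at most [f y - f x]; let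
    [t] tend to 0 from the right. *)
Lemma convex_tangent : convex_function [set: 'rV[R]_n] f ->
  forall x y, f x + fip (grad f x) (y - x) <= f y.
Proof.
move=> f_conv x y; rewrite -dotpE dotp_grad; set v := y - x.
rewrite addrC -lerBrDr.
have dv : derivable f x v := diff_derivable (f_diff x).
have dr := cvg_dnbhs_at_right dv.
rewrite /derive -(cvg_lim _ dr) //.
apply: limr_le; first by apply/cvg_ex; eexists; exact: dr.
near=> t.
have t0 : 0 < t by near: t; exact: nbhs_right_gt.
have t1 : t <= 1 by near: t; apply: nbhs_right_ltW.
have h : f (t *: y + (1 - t) *: x) <= t * f y + (1 - t) * f x.
  by have := f_conv (Itv01 (ltW t0) t1) y x; rewrite !inE => /(_ I I).
rewrite /= -[_ *: _]/(_ * _) ler_pdivrMl //.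
have -> : t *: v + x = t *: y + (1 - t) *: x.
  by rewrite /v scalerBr scalerBl scale1r addrAC addrA.
lra.
Unshelve. all: by end_near.
Qed.

End FirstOrder.

(** * Deviation from consensus *)

Section Centering.
Variables (R : realType) (m n : nat).
Hypothesis m_gt0 : (0 < m)%N.
Implicit Types (z : 'M[R]_(m, n)) (r : 'rV[R]_n).

Definition consensus r : 'M[R]_(m, n) := (const_mx 1 : 'cV_m) *m r.

Definition deviation z : 'M[R]_(m, n) := z - consensus (row_avg z).

Lemma row_consensus r i : row i (consensus r) = r.
Proof.
by rewrite row_mul row_const; apply/rowP => j; rewrite mxE big_ord1 mxE mul1r.
Qed.

Lemma row_deviation z i : row i (deviation z) = row i z - row_avg z.
Proof. by rewrite linearB /= row_consensus. Qed.

Lemma col_sum_row_avg z : (const_mx 1 : 'rV_m) *m z = m%:R *: row_avg z.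
Proof.
rewrite scalerA mulfV ?scale1r ?pnatr_eq0 -?lt0n //.
apply/rowP => j; rewrite mxE summxE; apply: eq_bigr => i _.
by rewrite !mxE mul1r.
Qed.

Lemma row_avgD (x z : 'M[R]_(m, n)) : row_avg (x + z) = row_avg x + row_avg z.
Proof.
rewrite /row_avg -scalerDr -big_split; congr (_ *: _).
by apply: eq_bigr => i _; rewrite linearD.
Qed.

Lemma fip_consensusr z r : fip z (consensus r) = m%:R * fip (row_avg z) r.
Proof.
rewrite fip_rows -fipZl scalerA mulfV ?scale1r ?pnatr_eq0 -?lt0n //.
by rewrite fip_suml; apply: eq_bigr => i _; rewrite row_consensus.
Qed.

Lemma deviation_orth z : (const_mx 1 : 'rV_m) *m deviation z = 0.
Proof.
rewrite mulmxBr col_sum_row_avg /consensus mulmxA.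
rewrite (_ : const_mx 1 *m const_mx 1 = (m%:R)%:M) ?mul_scalar_mx ?subrr //.
apply/matrixP => i j; rewrite !ord1 !mxE eqxx mulr1n.
under eq_bigr => k _ do rewrite !mxE mulr1.
by rewrite sumr_const card_ord.
Qed.

Lemma fip_cols (x y : 'M[R]_(m, n)) :
  fip x y = \sum_j fip (col j x)^T (col j y)^T.
Proof.
rewrite {1}/fip exchange_big; apply: eq_bigr => j _.
by rewrite -dotpE; apply: eq_bigr => i _; rewrite !mxE.
Qed.

Lemma fip_psd (M : 'M[R]_m) z : psd M -> 0 <= fip z (M *m z).
Proof.
move=> [_ hM]; rewrite fip_cols; apply: sumr_ge0 => j _.
have := hM (col j z); congr (_ <= _).
rewrite -mulmxA mxE -dotpE; apply: eq_bigr => i _.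
by rewrite !colE mulmxA !mxE.
Qed.

Variable W : 'M[R]_m.
Hypothesis symW : W^T = W.
Hypothesis W1 : W *m const_mx 1 = const_mx 1 :> 'cV[R]_m.
Hypothesis sig1 : sigma2 W < 1.

Lemma laplacian_consensus r : (1%:M - W) *m consensus r = 0.
Proof. by rewrite /consensus mulmxA mulmxBl W1 mul1mx subrr mul0mx. Qed.

Lemma laplacian_deviation z : (1%:M - W) *m deviation z = (1%:M - W) *m z.
Proof. by rewrite mulmxBr laplacian_consensus subr0. Qed.

Let symL : (1%:M - W)^T = 1%:M - W.
Proof. by rewrite linearB /= trmx1 symW. Qed.

(** [I - W] sees only the deviation of [z], whose columns are orthogonal to the all-ones vector, so
    [sigma2_rayleigh] applies columnwise. *)
Lemma deviation_gap z :
  (1 - sigma2 W) * fip (deviation z) (deviation z) <= fip z ((1%:M - W) *m z).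
Proof.
have -> : fip z ((1%:M - W) *m z) = fip (deviation z) ((1%:M - W) *m deviation z).
  rewrite laplacian_deviation /deviation fipDl fipNl (fip_mulmxC (consensus _)) //.
  by rewrite laplacian_consensus [fip z 0]fipC fip0l subr0.
have e (p : 'M[R]_(m, n)) : fip p ((1%:M - W) *m p) = fip p p - fip p (W *m p).
  by rewrite mulmxBl mul1mx fipDr fipNr.
rewrite e mulrBl mul1r lerD2l lerN2.
rewrite fip_cols [X in _ * X]fip_cols mulr_sumr; apply: ler_sum => j _.
have -> : (col j (W *m deviation z))^T = (col j (deviation z))^T *m W.
  by rewrite !colE -mulmxA trmx_mul symW.
apply: sigma2_rayleigh => //; apply: trmx_inj.
by rewrite trmx_mul trmxK trmx_const trmx0 colE mulmxA deviation_orth mul0mx.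
Qed.

(** Young's inequality for [deviation z] and [(I - W) z], weighted by [1 - sigma2 W]; the deviation
    term is absorbed through [deviation_gap]. *)
Lemma laplacian_norm_gap z :
  (1 - sigma2 W) * fip z ((1%:M - W) *m z) <=
  fip ((1%:M - W) *m z) ((1%:M - W) *m z).
Proof.
have c0 : 0 < 1 - sigma2 W by rewrite subr_gt0.
have hgap := deviation_gap z.
have eX : fip z ((1%:M - W) *m z) = fip (deviation z) ((1%:M - W) *m z).
  rewrite /deviation fipDl fipNl (fip_mulmxC (consensus _)) //.
  by rewrite laplacian_consensus [fip z 0]fipC fip0l subr0.
have := fip_young (deviation z) ((1%:M - W) *m z) c0; rewrite -eX => hy.
have : (1 - sigma2 W)^-1 * fip ((1%:M - W) *m z) ((1%:M - W) *m z) >=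
    fip z ((1%:M - W) *m z) by lra.
by rewrite ler_pdivlMl.
Qed.

(** Adding the all-ones matrix [J] to [I - W] gives an invertible [N]. As [J N = m J] and [J z = 0],
    the solution of [N q = z] has [J q = 0], so [N q = (I - W) q]. *)
Lemma laplacian_solve z : row_avg z = 0 -> exists q, z = (1%:M - W) *m q.
Proof.
move=> hz; pose J : 'M[R]_m := const_mx 1; pose N := 1%:M - W + J.
have Ju k (x : 'M[R]_(k, m)) : x *m J = x *m (const_mx 1 : 'cV_m) *m const_mx 1.
  rewrite -mulmxA; congr (_ *m _); apply/matrixP => i j.
  by rewrite !mxE big_ord1 !mxE mulr1.
have m0 : m%:R != 0 :> R by rewrite pnatr_eq0 -lt0n.
have N1 : N *m (const_mx 1 : 'cV_m) = m%:R *: (const_mx 1 : 'cV_m).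
  rewrite mulmxDl mulmxBl mul1mx W1 subrr add0r.
  apply/matrixP => i j; rewrite !mxE.
  under eq_bigr => k _ do rewrite !mxE mulr1.
  by rewrite sumr_const card_ord mulr1.
(* A left null vector is orthogonal to the all-ones vector by [N1], hence fixed by [W];
   [sigma2 W < 1] then makes it zero. *)
have Nu : N \in unitmx.
  rewrite -row_free_unit; apply: inj_row_free => x xN.
  have x1 : x *m (const_mx 1 : 'cV_m) = 0.
    have := congr1 (mulmx^~ (const_mx 1 : 'cV_m)) xN.
    rewrite mul0mx -mulmxA N1 -scalemxAr => /eqP.
    by rewrite scaler_eq0 (negPf m0) => /eqP.
  move: xN; rewrite mulmxDr Ju x1 mul0mx addr0 mulmxBr mulmx1 => /eqP.
  rewrite subr_eq0 => /eqP xW.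
  have := sigma2_rayleigh symW W1 sig1 x1; rewrite -xW -subr_ge0.
  rewrite -{2}[fip x x]mul1r -mulrBl nmulr_rge0 ?subr_lt0 // => xx.
  exact: fip_eq0.
exists (invmx N *m z).
have Nz : z = N *m (invmx N *m z) by rewrite mulKVmx.
rewrite {1}Nz {1}/N mulmxDl -[RHS]addr0; congr (_ + _).
have JN : J *m N = m%:R *: J.
  rewrite mulmxDr mulmxBr mulmx1.
  have -> : J *m W = J.
    apply: trmx_inj; rewrite trmx_mul symW trmx_const.
    have -> : const_mx 1 = (const_mx 1 : 'cV[R]_m) *m (const_mx 1 : 'rV[R]_m).
      by apply/matrixP => i j; rewrite !mxE big_ord1 !mxE mulr1.
    by rewrite mulmxA W1.
  rewrite subrr add0r; apply/matrixP => i j; rewrite !mxE.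
  under eq_bigr => k _ do rewrite !mxE mulr1.
  by rewrite sumr_const card_ord mulr1.
have Jz : J *m z = 0.
  have -> : J = (const_mx 1 : 'cV_m) *m (const_mx 1 : 'rV_m).
    by apply/matrixP => i j; rewrite !mxE big_ord1 !mxE mulr1.
  by rewrite -mulmxA col_sum_row_avg hz scaler0 mulmx0.
have := congr1 (mulmx J) Nz; rewrite Jz mulmxA JN -scalemxAl => /esym/eqP.
by rewrite scaler_eq0 (negPf m0) => /eqP.
Qed.

End Centering.

(** * The regularized objective *)

Section Objective.
Variables (R : realType) (m n : nat) (f : 'I_m -> 'rV[R]_n -> R) (L eps : R).
Hypothesis m_gt0 : (0 < m)%N.
Hypothesis f_diff : forall i x, differentiable (f i) x.
Hypothesis f_conv : forall i, convex_function [set: 'rV[R]_n] (f i).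
Hypothesis L_gt0 : 0 < L.
Hypothesis f_smooth : forall i, smooth L (f i).
Hypothesis eps_gt0 : 0 < eps.
Local Notation g := (reg_grad f eps).

Definition total_obj (x : 'M[R]_(m, n)) : R :=
  \sum_i (f i (row i x) + eps / 2 * fip (row i x) (row i x)).

Lemma row_reg_grad x i : row i (g x) = grad (f i) (row i x) + eps *: row i x.
Proof. by apply/rowP => j; rewrite !mxE. Qed.

Lemma total_obj_lower x y :
  total_obj x + fip (g x) (y - x) + eps / 2 * fip (y - x) (y - x) <= total_obj y.
Proof.
rewrite [fip (g x) _]fip_rows [fip (y - x) _]fip_rows mulr_sumr -!big_split.
apply: ler_sum => i _ /=; rewrite row_reg_grad linearB /=.
have := convex_tangent (f_diff i) (@f_conv i) (row i x) (row i y).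
move: (row i x) (row i y) => u v; rewrite !fipE (fipC v u); lra.
Qed.

Lemma total_obj_upper x y :
  total_obj y <=
  total_obj x + fip (g x) (y - x) + (L + eps) / 2 * fip (y - x) (y - x).
Proof.
rewrite [fip (g x) _]fip_rows [fip (y - x) _]fip_rows mulr_sumr -!big_split.
apply: ler_sum => i _ /=; rewrite row_reg_grad linearB /=.
have := f_smooth i (row i x) (row i y); rewrite sqnormE dotpE.
move: (row i x) (row i y) => u v; rewrite !fipE (fipC v u); lra.
Qed.

Lemma total_obj_consensus r : total_obj (consensus m r) = m%:R * reg_obj f eps r.
Proof.
rewrite /total_obj; under eq_bigr => i _ do rewrite row_consensus.
rewrite big_split sumr_const card_ord /= /reg_obj /avg_obj sqnormE mulrDr.
by rewrite mulVKf ?mulr_natl // pnatr_eq0 -lt0n.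
Qed.

(** Both Bregman bounds apply to [f i] itself with [mu = 0]: [|G|^2 <= 2 L D] and
    [D <= L / 2 * |x - y|^2]. *)
Lemma grad_lipschitz i x y :
  fip (grad (f i) x - grad (f i) y) (grad (f i) x - grad (f i) y) <=
  L ^+ 2 * fip (x - y) (x - y).
Proof.
have lo u v : f i u + fip (grad (f i) u) (v - u) + 0 / 2 * fip (v - u) (v - u)
    <= f i v by rewrite !mul0r addr0; exact: (convex_tangent (f_diff i) (@f_conv i)).
have up u v : f i v <= f i u + fip (grad (f i) u) (v - u) +
    L / 2 * fip (v - u) (v - u) by rewrite -dotpE -sqnormE; exact: f_smooth.
have := bregman_coco L_gt0 (lexx 0) lo up y x.
have := bregman_le up y x; rewrite -(ler_pM2l L_gt0); lra.
Qed.

Variables (xstar xeps : 'rV[R]_n).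
Hypothesis xeps_min : is_minimizer (reg_obj f eps) xeps.
Hypothesis xstar_min : is_minimizer (avg_obj f) xstar.

(** Moving from [xeps] by [- s / (L + eps)], with [s] the averaged gradient, would lower the
    objective by at least [|s|^2 / (2 (L + eps))], so minimality forces [s = 0]. *)
Lemma row_avg_grad_min : row_avg (g (consensus m xeps)) = 0.
Proof.
set s := row_avg _; pose r := xeps - (L + eps)^-1 *: s.
have l0 : 0 < L + eps by rewrite addr_gt0.
have m0 : 0 < m%:R :> R by rewrite ltr0n.
have := total_obj_upper (consensus m xeps) (consensus m r).
have -> : consensus m r - consensus m xeps = consensus m (- ((L + eps)^-1 *: s)).
  by rewrite /consensus -mulmxBr /r addrAC subrr add0r.
have avgc (w : 'rV[R]_n) : row_avg (consensus m w) = w.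
  rewrite /row_avg; under eq_bigr => i _ do rewrite row_consensus.
  by rewrite sumr_const card_ord -[w *+ m]scaler_nat scalerA mulVf ?scale1r ?gt_eqF.
rewrite !fip_consensusr // !total_obj_consensus avgc -/s.
clearbody s; rewrite !fipE opprK.
have := xeps_min r; rewrite -(ler_pM2l m0) => h1 h2; have := le_trans h1 h2.
rewrite -addrA -{1}[_ * reg_obj _ _ _]addr0 lerD2l => h3.
apply: fip_eq0; rewrite -(pmulr_rle0 _ (_ : 0 < m%:R * (L + eps)^-1 / 2)).
  apply: le_trans (_ : 0 <= 0) => //; rewrite -oppr_ge0; move: h3; congr (_ <= _).
  by field; rewrite gt_eqF.
by rewrite !mulr_gt0 ?invr_gt0.
Qed.

(** Adding the two minimality inequalities cancels [avg_obj]. *)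
Lemma sqnorm_xeps : fip xeps xeps <= fip xstar xstar.
Proof.
have := xeps_min xstar; have := xstar_min xeps; rewrite /reg_obj !sqnormE => h1 h2.
have : eps / 2 * fip xeps xeps <= eps / 2 * fip xstar xstar by lra.
by rewrite ler_pM2l // divr_gt0.
Qed.

(* Two first-order bounds at xhat: at the consensus point, and at its mirror
   image, where the Bregman distance is nonnegative. *)
Lemma consensus_gap x :
  m%:R * (reg_obj f eps (row_avg x) - reg_obj f eps xeps) <=
  2 * bregman total_obj g (consensus m xeps) x
  + (L + eps) * fip (deviation x) (deviation x).
Proof.
set xs := consensus m xeps; set cx := consensus m (row_avg x).
have -> : m%:R * (reg_obj f eps (row_avg x) - reg_obj f eps xeps) =
    bregman total_obj g xs cx.
  rewrite /bregman !total_obj_consensus -mulrBr /cx /xs /consensus -mulmxBr.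
  by rewrite -/(consensus _ _) fip_consensusr // row_avg_grad_min fip0l mulr0 subr0.
have := bregman_upper total_obj_upper xs x cx.
have := bregman_upper total_obj_upper xs x (x + deviation x).
have := bregman_ge0 (ltW eps_gt0) total_obj_lower xs (x + deviation x).
have -> : cx - x = - deviation x by rewrite /deviation opprB.
have -> : x + deviation x - x = deviation x by rewrite addrAC subrr add0r.
move: (deviation x) => z.
rewrite !(fipNl, fipNr) opprK; lra.
Qed.

End Objective.

(** * Rates and constants of the two stages *)

(* 106 = 2 * 53, where 53 (L / eps + 1 / c) bounds the inverse of the contraction
   rate; c stands for 1 - sigma2. *)
Lemma rate_bound (R : realType) (L eps c : R) (k : nat) :
  0 < L -> 0 < eps -> 0 < c <= 1 ->
  106 * ((L / eps + c^-1) * ln c^-1) <= k%:R ->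
  (1 - (1 + 48 / c + 4 * (L + eps) / eps)^-1) ^+ k <= c ^+ 2.
Proof.
move=> L0 eps0 /andP[c0 c1] hk; set X := L / eps + c^-1 in hk.
have Le0 : 0 < L / eps by rewrite divr_gt0.
have ci1 : 1 <= c^-1 by rewrite -[1]invr1 lef_pV2 ?posrE.
set dt := (1 + _ + _).
(* [53 = 1 + 48 + 4] in units of [1 / c >= 1]; the 4 comes from
   [4 (L + eps) / eps = 4 L / eps + 4]. *)
have dtX : dt <= 53 * X.
  rewrite /dt mulrDr mulrDl mulfK ?gt_eqF // /X; lra.
have dt1 : 1 <= dt.
  rewrite /dt -addrA lerDl addr_ge0 // ?divr_ge0 ?mulr_ge0 ?addr_ge0 // ltW //.
have dt0 : 0 < dt by apply: lt_le_trans dt1.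
have lnc : 0 <= ln c^-1 by rewrite ln_ge0.
have h : 2 * ln c^-1 <= dt^-1 * k%:R.
  rewrite ler_pdivlMl //; apply: le_trans hk.
  rewrite (_ : 106 * (X * _) = 53 * X * (2 * ln c^-1)); last by ring.
  by rewrite ler_wpM2r // mulr_ge0.
apply: le_trans (_ : expR (- dt^-1) ^+ k <= _).
  by rewrite lerXn2r ?nnegrE ?expR_ge0 ?subr_ge0 ?invf_le1 // expR_ge1Dx.
rewrite -expRM_natr -[c in leRHS]lnK ?posrE // -expRM_natr ler_expR.
move: h; rewrite lnV ?posrE //; lra.
Qed.

(** The three summands of [C2] serve the three conclusions in turn. The maximum with 1 gives
    [C2 * eps <= eps * k], which handles the part of [G] of order [eps]. *)
Lemma complexity_bound (R : realType) (L eps R1 R2 T G k : R) :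
  0 < L -> 0 < eps -> 0 < R1 -> 0 < R2 -> 0 <= T ->
  G <= T * (L * R1 + R2 / L) + 57 * eps * R1 ->
  (1 + 9 * (T + 57 * R1) + 8 * (T + 57) / R2) *
    Num.max 1 ((L * R1 + R2 / L) / eps) <= k ->
  [/\ 1 <= k, 9 * G <= eps * k & 8 * G <= eps ^+ 2 * ((L + eps) * k ^+ 2)].
Proof.
move=> L0 eps0 R10 R20 T0 hG.
set A := L * R1 + R2 / L in hG *; set C2 := 1 + _ + _ => hk.
have h1 : 0 <= 9 * (T + 57 * R1) by rewrite !(mulr_ge0, addr_ge0) // ltW.
have h2 : 0 <= 8 * (T + 57) / R2 by rewrite !(divr_ge0, mulr_ge0, addr_ge0) // ltW.
have C2_ge1 : 1 <= C2 by rewrite /C2; lra.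
have C2_gt0 : 0 < C2 by apply: lt_le_trans C2_ge1.
have A0 : 0 < A by rewrite addr_gt0 ?divr_gt0 ?mulr_gt0.
have k1 : C2 <= k.
  by apply: le_trans hk; rewrite ler_peMr ?le_max ?lexx // ltW.
have kA : C2 * A <= eps * k.
  have : C2 * (A / eps) <= k.
    by apply: le_trans hk; rewrite ler_wpM2l ?le_max ?lexx ?orbT // ltW.
  by rewrite mulrA ler_pdivrMr // [k * _]mulrC.
have ke : C2 * eps <= eps * k by rewrite mulrC ler_pM2l.
split; first by lra.
  pose w := eps * k / C2.
  have Aw : T * A <= T * w by rewrite ler_wpM2l // ler_pdivlMr // mulrC.
  have ew : R1 * eps <= R1 * w by rewrite ler_pM2l // ler_pdivlMr // mulrC.
  have w0 : 0 <= w by apply: le_trans (ltW A0) _; rewrite ler_pdivlMr // mulrC.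
  have wE : eps * k = C2 * w by rewrite [RHS]mulrC /w divfK ?gt_eqF.
  have : 0 <= 8 * (T + 57) / R2 * w by apply: mulr_ge0.
  rewrite wE /C2; lra.
have AL : R2 <= A * L.
  rewrite mulrDl divfK ?gt_eqF // lerDr.
  by rewrite !mulr_ge0 // ltW.
(* [R1 * R2] is the product of the two summands of [A]. *)
have AA : R1 * R2 <= A ^+ 2.
  rewrite expr2; apply: le_trans (_ : R1 * (A * L) <= _).
    by rewrite ler_pM2l.
  rewrite mulrCA ler_pM2l // mulrC lerDl.
  by rewrite divr_ge0 // ltW.
have b1 : A * R2 <= A ^+ 2 * (L + eps).
  rewrite expr2 -mulrA ler_pM2l // mulrDr; apply: le_trans AL _.
  by rewrite lerDl mulr_ge0 // ltW.
have b2 : eps * R1 * R2 <= A ^+ 2 * (L + eps).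
  apply: le_trans (_ : A ^+ 2 * eps <= _); last first.
    by rewrite ler_pM2l ?exprn_gt0 // lerDr ltW.
  by rewrite -mulrA mulrC ler_pM2r.
have b3 : 8 * G <= 8 * (T + 57) / R2 * (A ^+ 2 * (L + eps)).
  rewrite mulrAC ler_pdivlMr //.
  have := ler_wpM2l T0 b1; have := ler_wpM2r (ltW R20) hG; lra.
apply: le_trans b3 _.
have S0 : 0 <= A ^+ 2 * (L + eps) by rewrite mulr_ge0 ?sqr_ge0 // addr_ge0 ?ltW.
apply: le_trans (_ : C2 * (A ^+ 2 * (L + eps)) <= _).
  by rewrite ler_wpM2r // /C2; lra.
apply: le_trans (_ : (C2 * A) ^+ 2 * (L + eps) <= _).
  have -> : (C2 * A) ^+ 2 * (L + eps) = C2 * C2 * (A ^+ 2 * (L + eps)) by ring.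
  by apply: ler_wpM2r => //; rewrite ler_peMl // ltW.
rewrite [leRHS](_ : _ = (eps * k) ^+ 2 * (L + eps)); last by ring.
apply: ler_wpM2r; first by rewrite addr_ge0 ?ltW.
rewrite lerXn2r ?nnegrE //; first by rewrite mulr_ge0 // ltW.
by rewrite mulr_ge0 ?(ltW eps0) // (le_trans (ltW C2_gt0)).
Qed.

(** [U *m U] is [(I - W) / 2], or 0 if [sqrtmx] takes its default; either way its columns sum to
    zero, and those of [v] lie in their span. *)
Lemma span_row_avg (R : realType) m n (W : 'M[R]_m) (v : 'M[R]_(m, n)) :
  (0 < m)%N -> W^T = W -> W *m const_mx 1 = const_mx 1 :> 'cV[R]_m ->
  let U := sqrtmx (2^-1 *: (1%:M - W)) in
  (v^T <= (U *m U)^T)%MS -> row_avg v = 0.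
Proof.
move=> m0 symW W1 U /submxP[D vD].
have UU1 : (U *m U)^T *m (const_mx 1 : 'cV_m) = 0.
  rewrite /U /sqrtmx; case: xgetP => [V _ [_ ->]|_]; last first.
    by rewrite mul0mx trmx0 mul0mx.
  by rewrite linearZ linearB /= trmx1 symW -scalemxAl mulmxBl mul1mx W1 subrr scaler0.
have m1 : (m%:R : R) != 0 by rewrite pnatr_eq0 -lt0n.
have : m%:R *: row_avg v = 0.
  rewrite -col_sum_row_avg //; apply: trmx_inj.
  by rewrite trmx_mul trmx_const vD -mulmxA UU1 mulmx0 trmx0.
by move=> /eqP; rewrite scaler_eq0 (negPf m1) => /eqP.
Qed.

(** [V] stands for the bound on the rows of [v^0]; [V / L = V / R2 * (R2 / L)] moves it into the
    constant. [109 = 45 + 64] collects the multiples of [L * R1]. *)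
Lemma initial_constant (R : realType) (L eps R1 R2 V : R) :
  0 < L -> 0 < eps -> 0 < R1 -> 0 < R2 -> 0 <= V ->
  45 * (L + eps) * R1 + 4 / (L + eps) *
    (V + 4 * R2 + 16 * L ^+ 2 * R1 + 2 * eps ^+ 2 * R1) <=
  (109 + 4 * V / R2) * (L * R1 + R2 / L) + 57 * eps * R1.
Proof.
move=> L0 e0 R10 R20 V0; have l0 : 0 < L + eps by rewrite addr_gt0.
have b1 : (V + 4 * R2) / (L + eps) <= (V + 4 * R2) / L.
  rewrite ler_wpM2l ?addr_ge0 ?mulr_ge0 ?(ltW R20) //.
  by rewrite lef_pV2 ?posrE // lerDl ltW.
have b2 : L ^+ 2 * R1 / (L + eps) <= L * R1.
  rewrite ler_pdivrMr // -subr_ge0 (_ : _ - _ = L * R1 * eps); last by ring.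
  by rewrite !mulr_ge0 ?ltW.
have b3 : eps ^+ 2 * R1 / (L + eps) <= eps * R1.
  rewrite ler_pdivrMr // -subr_ge0 (_ : _ - _ = L * R1 * eps); last by ring.
  by rewrite !mulr_ge0 ?ltW.
have b4 : 0 <= V / R2 * (L * R1) by rewrite !mulr_ge0 ?invr_ge0 // ltW.
have b5 : V / R2 * (R2 / L) = V / L by field; rewrite !gt_eqF.
have b6 : 0 <= R2 / L by rewrite divr_ge0 ?ltW.
have b7 : 0 <= eps * R1 by rewrite mulr_ge0 ?ltW.
move: b1; rewrite [X in _ <= X -> _]mulrDl => b1.
rewrite (_ : 4 / (L + eps) * _ = 4 * ((V + 4 * R2) / (L + eps)) +
  64 * (L ^+ 2 * R1 / (L + eps)) + 8 * (eps ^+ 2 * R1 / (L + eps))); last by ring.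
rewrite [leRHS](_ : _ = 109 * (L * R1) + 109 * (R2 / L) +
  4 * (V / R2 * (L * R1)) + 4 * (V / R2 * (R2 / L)) + 57 * (eps * R1)); last by ring.
rewrite b5; lra.
Qed.

(** * Assembly of the two stages *)

(* C1 and C2 are the constants hidden in the two O's: they may depend on R1, R2
   and on a bound Rv for the rows of v^0, and on nothing else. *)
Theorem lemma2 (R : realType) (R1 R2 Rv : R) (hR1 : 0 < R1) (hR2 : 0 < R2) :
  exists C1 C2 : R, [/\ 0 < C1, 0 < C2 &
    forall (m n : nat) (hm : (0 < m)%N)
      (nbr : rel 'I_m) (hnbr : simple_graph nbr)
      (W : 'M[R]_m) (hW : weight_matrix nbr W)
      (f : 'I_m -> 'rV[R]_n -> R)
      (hdiff : forall i x, differentiable (f i) x)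
      (hconv : forall i, convex_function [set: 'rV[R]_n] (f i))
      (L : R) (hL : 0 < L) (hsmooth : forall i, smooth L (f i))
      (eps : R) (heps : 0 < eps)
      (xstar : 'rV[R]_n) (hxstar : is_minimizer (avg_obj f) xstar)
      (xeps : 'rV[R]_n) (hxeps : is_minimizer (reg_obj f eps) xeps)
      (x0 v0 : 'M[R]_(m, n))
      (hx0 : forall i, sqnorm (row i x0 - xstar) <= R1)
      (hxstarR1 : sqnorm xstar <= R1)
      (hgrad : forall i, sqnorm (grad (f i) xstar) <= R2)
      (hv0 : forall i, sqnorm (row i v0) <= Rv),
    let U := sqrtmx (2^-1 *: (1%:M - W)) in
    (v0^T <= (U *m U)^T)%MS ->
    let Leps := L + eps in
    let beta := Leps in
    let alpha := (2 * (Leps + beta))^-1 in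
    let run := extra (reg_grad f eps) W alpha beta in
    forall K0 K : nat,
      C1 * ((L / eps + (1 - sigma2 W)^-1) * ln (1 - sigma2 W)^-1) <= K0%:R ->
      C2 * Num.max 1 ((L * R1 + R2 / L) / eps) <= K%:R ->
      let stage1 := run (x0, v0) K0 in
      let xhat := K%:R^-1 *: \sum_(1 <= k < K.+1) (run stage1 k).1 in
      reg_obj f eps (row_avg xhat) - reg_obj f eps xeps <= eps /\
      m%:R^-1 * \sum_i sqnorm (row i xhat - row_avg xhat) <= eps ^+ 2].
Proof.
(* [Rv] is arbitrary at this point; the maximum with 0 keeps the constants positive. *)
pose Rv' := Num.max 0 Rv; pose T := 109 + 4 * Rv' / R2.
have Rv'0 : 0 <= Rv' by rewrite le_max lexx.
have T0 : 0 <= T by rewrite addr_ge0 // divr_ge0 ?mulr_ge0 // ltW.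
have C20 : 0 < 1 + 9 * (T + 57 * R1) + 8 * (T + 57) / R2.
  by rewrite !(ltr_pwDl, addr_ge0, divr_ge0, mulr_ge0) // ltW.
exists 106, (1 + 9 * (T + 57 * R1) + 8 * (T + 57) / R2); split => //.
move=> m n hm nbr _ W [_ symW [psdL psdU] W1 sig1] f hdiff hconv L hL hsmooth
  eps heps xstar hxstar xeps hxeps x0 v0 hx0 hxs hgrad hv0 U hspan Leps beta
  alpha run K0 K hK0 hK stage1 xhat.
set c := 1 - sigma2 W in hK0.
have c0 : 0 < c by rewrite subr_gt0.
have c1 : c <= 1 by rewrite gerBl sigma2_ge0.
have l0 : 0 < Leps by rewrite addr_gt0.
have m0 : 0 < m%:R :> R by rewrite ltr0n.
pose xs := consensus m xeps; pose g := reg_grad f eps; pose h := total_obj f eps.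
pose A := (Leps / 2) *: (1%:M - W).
have h_lower := total_obj_lower eps hdiff hconv : forall x y : 'M[R]_(m, n), _.
have h_upper := total_obj_upper eps hsmooth : forall x y : 'M[R]_(m, n), _.
have AE (z : 'M[R]_(m, n)) : A *m z = (Leps / 2) *: ((1%:M - W) *m z).
  by rewrite -scalemxAl.
have l20 : 0 < Leps / 2 by rewrite divr_gt0.
have symA : A^T = A by rewrite linearZ linearB /= trmx1 symW.
have A_ge0 (z : 'M[R]_(m, n)) : 0 <= fip z (A *m z).
  by rewrite AE fipZr mulr_ge0 ?fip_psd // ltW.
have A_le (z : 'M[R]_(m, n)) : fip z (A *m z) <= Leps * fip z z.
  rewrite AE fipZr -mulrA ler_pM2l // ler_pdivrMl //.
  have := fip_psd z psdU; rewrite !(mulmxDl, mulNmx, mul1mx, fipDr, fipNr); lra.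
have A_gap (z : 'M[R]_(m, n)) :
    Leps * c * fip z (A *m z) <= 2 * fip (A *m z) (A *m z).
  rewrite AE !(fipZr, fipZl).
  have := laplacian_norm_gap hm symW W1 sig1 z; rewrite -/c.
  rewrite -(ler_pM2l (_ : 0 < Leps * (Leps / 2))) ?mulr_gt0 //; lra.
have A_xs : A *m xs = 0 by rewrite AE laplacian_consensus // scaler0.
have [q0 hq0] : exists q0, dual_cert g Leps W xs (x0, v0) q0.
  have [|q hq] := @laplacian_solve _ _ _ hm W symW W1 sig1 (v0 + g xs).
    rewrite row_avgD (span_row_avg hm symW W1 hspan) add0r.
    by have := row_avg_grad_min hm hL hsmooth heps hxeps.
  exists ((Leps / 2)^-1 *: q); rewrite /dual_cert /= hq -scalemxAr -scalemxAl.
  by rewrite scalerA mulVf ?scale1r ?gt_eqF.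
pose r := 4 * R2 + 16 * L ^+ 2 * R1 + 2 * eps ^+ 2 * R1.
(* [m * G] will bound [c] times the initial Lyapunov value: [45 = (4 + 1 / 2) * 10] from the primal
   error and [D], where [10 = 2 + 2 * 4] comes from splitting at [xstar]; [4 / Leps] comes from the
   dual error through [A_gap]. *)
pose G := 45 * Leps * R1 + 4 / Leps * (Rv' + r).
have sum_le (z : 'M[R]_(m, n)) b :
    (forall i, fip (row i z) (row i z) <= b) -> fip z z <= m%:R * b.
  move=> hb; rewrite fip_rows.
  have -> : m%:R * b = \sum_(i < m) b by rewrite sumr_const card_ord mulr_natl.
  by apply: ler_sum.
rewrite sqnormE in hxs.
have xeps_R1 : fip xeps xeps <= R1.
  exact: le_trans (sqnorm_xeps heps hxeps hxstar) hxs.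
have dist_R1 : fip (xeps - xstar) (xeps - xstar) <= 4 * R1.
  by have := fipB_le xeps xstar; lra.
have hy : fip (x0 - xs) (x0 - xs) <= m%:R * (10 * R1).
  apply: sum_le => i; rewrite linearB /= row_consensus.
  have := fipB_le (row i x0 - xstar) (xeps - xstar); have := hx0 i.
  rewrite sqnormE opprB addrA subrK; lra.
have hgs : fip (g xs) (g xs) <= m%:R * r.
  apply: sum_le => i; rewrite row_reg_grad row_consensus.
  have := fipD_le (grad (f i) xeps) (eps *: xeps).
  have := fipD_le (grad (f i) xeps - grad (f i) xstar) (grad (f i) xstar).
  have := grad_lipschitz hdiff hconv hL hsmooth i xeps xstar; rewrite subrK.
  have := hgrad i; rewrite sqnormE => b1 b2 b3.
  have b4 : L ^+ 2 * fip (xeps - xstar) (xeps - xstar) <= L ^+ 2 * (4 * R1).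
    by rewrite ler_wpM2l // sqr_ge0.
  have b5 : fip (eps *: xeps) (eps *: xeps) <= eps ^+ 2 * R1.
    by rewrite fipZl fipZr mulrA -expr2 ler_wpM2l // sqr_ge0.
  rewrite /r; lra.
have hv : fip v0 v0 <= m%:R * Rv'.
  by apply: sum_le => i; rewrite -sqnormE le_max hv0 orbT.
have hV0 : c * lyapunov h g Leps W xs (x0, v0) q0 <= m%:R * G.
  have := A_gap q0; rewrite -{2 3}hq0 /=; have := fipD_le v0 (g xs).
  have := bregman_le h_upper xs x0; have := fip_ge0 (x0 - xs).
  rewrite /lyapunov /energy /= -/A -/g -/h.
  set Y := fip (x0 - xs) _ in hy *; set Q := fip q0 _.
  set D0 := bregman _ _ _ _; set S := fip (v0 + g xs) _ => Y0 hD hS hQ.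
  have hcQ : c * Q <= 4 / Leps * (m%:R * (Rv' + r)).
    rewrite mulrAC ler_pdivlMr //; lra.
  have hcY : c * (4 * Leps * Y + D0) <= 9 / 2 * (Leps * (m%:R * (10 * R1))).
    apply: le_trans (_ : c * (9 / 2 * (Leps * (m%:R * (10 * R1)))) <= _).
      rewrite ler_pM2l //.
      have : Leps * Y <= Leps * (m%:R * (10 * R1)) by rewrite ler_pM2l.
      by rewrite -/Leps in hD; lra.
    by rewrite ler_piMl // !mulr_ge0 // ltW.
  by rewrite /G; lra.
have [q1 hq1 hV1] := lyapunov_iter heps l0 c0 h_lower h_upper symA
   A_ge0 A_le A_gap A_xs K0 hq0.
have rate := rate_bound hL heps (introT andP (conj c0 c1)) hK0.
(* Of the factor [c ^+ 2] gained in the first stage, one [c] is spent on [hV0] and the other is kept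
   for [hdev]. *)
have hE : energy Leps W xs stage1 q1 <= c * (m%:R * G).
  apply: le_trans (energy_le_lyapunov _ _ _ heps h_lower _ _) _.
  apply: le_trans hV1 _.
  apply: le_trans (_ : c ^+ 2 * lyapunov h g Leps W xs (x0, v0) q0 <= _).
    by rewrite ler_wpM2r // addr_ge0 ?energy_ge0 // (bregman_ge0 (ltW heps) h_lower).
  by rewrite expr2 -mulrA ler_pM2l.
have hG : G <= T * (L * R1 + R2 / L) + 57 * eps * R1.
  by rewrite /G /r /T !addrA; apply: initial_constant.
have [k1 b1 b2] := complexity_bound hL heps hR1 hR2 T0 hG hK.
have K_gt0 : (0 < K)%N by rewrite -(ltr0n R); apply: lt_le_trans k1.
have [] := ergodic_bounds heps l0 h_lower h_upper symA A_ge0 A_le A_xs K_gt0 hq1 hE.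
rewrite -/alpha -/run -/xhat => hD hX.
have eX : fip (xhat - xs) (A *m (xhat - xs)) =
    Leps / 2 * fip xhat ((1%:M - W) *m xhat).
  rewrite mulmxBr A_xs subr0 fipDl fipNl (fip_mulmxC xs _ symA) A_xs.
  by rewrite [fip xhat 0]fipC fip0l subr0 AE fipZr.
move: hX; rewrite -/A eX => hX.
set dev := fip (deviation xhat) (deviation xhat).
have dev0 : 0 <= dev by exact: fip_ge0.
have K0' : 0 < K%:R :> R by rewrite ltr0n.
have lK0 : 0 < Leps * K%:R ^+ 2 by rewrite mulr_gt0 ?exprn_gt0.
have hdev : Leps * K%:R ^+ 2 * dev <= 8 * (m%:R * G).
  rewrite -(ler_pM2l c0).
  have := ler_wpM2l (ltW lK0) (deviation_gap hm symW W1 sig1 xhat).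
  rewrite -/c -/dev; lra.
have mG0 : 0 <= m%:R * G.
  by have : 0 <= Leps * K%:R ^+ 2 * dev; [rewrite !mulr_ge0 // ltW | lra].
split; last first.
  have -> : \sum_i sqnorm (row i xhat - row_avg xhat) = dev.
    by rewrite /dev fip_rows; apply: eq_bigr => i _; rewrite sqnormE row_deviation.
  rewrite ler_pdivrMl // -(ler_pM2l lK0); apply: le_trans hdev _.
  have := ler_wpM2l (ltW m0) b2; rewrite -/Leps; lra.
have hgap := consensus_gap hm hdiff hconv hL hsmooth heps hxeps xhat.
rewrite -(ler_pM2l m0) -(ler_pM2l K0').
(* [9 = 1 + 8]: [2 K D] is at most [m G], and [K * Leps * dev <= K ^+ 2 * Leps * dev] is at most
   [8 m G]. *)
apply: le_trans (_ : 9 * (m%:R * G) <= _); last first.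
  have := ler_wpM2l (ltW m0) b1; lra.
apply: le_trans (ler_wpM2l (ltW K0') hgap) _; rewrite -/dev.
have : c * (m%:R * G) <= m%:R * G by rewrite ler_piMl.
have : Leps * dev * K%:R <= Leps * dev * K%:R * K%:R.
  by rewrite ler_peMr // !mulr_ge0 // ltW.
rewrite -/Leps -/g -/h -/xs; lra.
Qed.
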